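(* Let $\mathbf{k}$ be an algebraically closed field of characteristic $0$, let $n\ge 3$, let $V$ be an $n$-dimensional $\mathbf{k}$-vector space with basis $\{e_1,\dots,e_n\}$, and let $\Gamma=(\mathsf{V},\mathsf{E})$ be a simple undirected graph with vertex set $\mathsf{V}=\{1,\dots,n\}$. Let $W_\Gamma$ be the Koszul module of $\Gamma$ and let $\mathcal{R}^{\mathrm{Fitt}}_\Gamma=\operatorname{Spec}(S/\operatorname{Fitt}_0(W_\Gamma))$. Then the scheme $\mathcal{R}^{\mathrm{Fitt}}_\Gamma$ is reduced if and only if one of the following conditions is satisfied: (i) $\Gamma$ is disconnected; (ii) $\Gamma$ is the complete graph $K_n$ with $n$ vertices; (iii) $\Gamma$ is obtained from $K_n$ by removing an edge; (iv) $\Gamma$ is the cycle graph $C_4$ with $4$ vertices.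
   Context: Let $S=\operatorname{Sym}(V)=\mathbf{k}[x_1,\dots,x_n]$, where $x_i$ corresponds to $e_i$. For a linear subspace $K\subseteq\bigwedge^2V$, the Koszul module is the graded $S$-module $W(V,K)=\operatorname{coker}\left(\bigwedge^3V\otimes S(-1)\xrightarrow{\ \pi\circ\delta_3\ }(\bigwedge^2V/K)\otimes S\right)$, where $\pi:\bigwedge^2V\otimes S\to(\bigwedge^2V/K)\otimes S$ is the canonical projection and $\delta_3$ is the Koszul differential $a\wedge b\wedge c\otimes f\mapsto a\wedge b\otimes cf-a\wedge c\otimes bf+b\wedge c\otimes af$. For a graph $\Gamma=(\mathsf{V},\mathsf{E})$ on $\{1,\dots,n\}$, let $K_\Gamma\subseteq\bigwedge^2V$ be the span of all $e_i\wedge e_j$ with $(i,j)\in\mathsf{E}$, and put $W_\Gamma=W(V,K_\Gamma)$. $\operatorname{Fitt}_0(W_\Gamma)\subseteq S$ is the $0$-th Fitting ideal of $W_\Gamma$, i.e. the ideal generated by the maximal minors of the matrix of the $S$-linear map $\pi\circ\delta_3:\bigwedge^3V\otimes S(-1)\to(\bigwedge^2V/K_\Gamma)\otimes S$, of size $\dim(\bigwedge^2V/K_\Gamma)$ (equal to $S$ if $W_\Gamma=0$). The scheme is reduced exactly when $\operatorname{Fitt}_0(W_\Gamma)$ is a radical ideal (possibly equal to $S$). *)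

(* Defs.v *)
From HB Require Import structures.
From mathcomp Require Import all_boot all_order all_algebra.
From mathcomp Require Import mpoly.

Set Implicit Arguments.
Unset Strict Implicit.
Unset Printing Implicit Defensive.

Import GRing.Theory.
Local Open Scope ring_scope.

(* Strictly increasing p-tuples of indices below n: they index the basis of
   the p-th exterior power of an n-dimensional space, and also the choices of
   p columns in an n-column matrix. *)
Definition incr (p n : nat) : Type :=
  {f : {ffun 'I_p -> 'I_n} |
     [forall i : 'I_p, forall j : 'I_p, (i < j)%N ==> (f i < f j)%N]}.

HB.instance Definition _ p n := Finite.on (incr p n).

Definition incr_fun p n (A : incr p n) : 'I_p -> 'I_n := val A.
Coercion incr_fun : incr >-> Funclass.

Section Exterior.

Variable n : nat.

(* Free R-module with basis e_A = e_(A 0) /\ ... /\ e_(A p-1).  For R = k this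
   is the p-th exterior power of V, in coordinates with respect to the basis e
   of V; for R = {mpoly k[n]} it is the p-th exterior power tensored with
   S = Sym(V). *)
Definition ext (R : nzRingType) (p : nat) : Type := {ffun incr p n -> R^o}.

HB.instance Definition _ (R : nzRingType) p := Vector.on (ext R p).

Definition ext_basis (R : nzRingType) p (A : incr p n) : ext R p :=
  [ffun B : incr p n => (B == A)%:R : R^o].

Variables (k : fieldType) (V : vectType k) (e : n.-tuple V).

(* v_0 /\ ... /\ v_(p-1): its coordinates are the p x p minors of the matrix of
   coordinates of the v_r. *)
Definition wedge p (v : p.-tuple V) : ext k p :=
  [ffun A : incr p n =>
     \det (\matrix_(r < p, s < p) coord e (A s) (tnth v r)) : k^o].

(* The inclusion of V in S = Sym(V), sending the i-th basis vector to 'X_i. *)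
Definition toSym (v : V) : {mpoly k[n]} := \sum_(i < n) coord e i v *: 'X_i.

(* The element w (x) f. *)
Definition tens p (w : ext k p) (f : {mpoly k[n]}) : ext {mpoly k[n]} p :=
  [ffun A : incr p n => (w A)%:MP * f : {mpoly k[n]}^o].

(* The Koszul differential, as the S-linear extension of
   a /\ b /\ c (x) f |->
     a /\ b (x) c f - a /\ c (x) b f + b /\ c (x) a f
   from the basis vectors a /\ b /\ c = e_T. *)
Definition koszul_delta3 (w : ext {mpoly k[n]} 3) : ext {mpoly k[n]} 2 :=
  \sum_(T : incr 3 n)
    let a := tnth e (T (inord 0)) in
    let b := tnth e (T (inord 1)) in
    let c := tnth e (T (inord 2)) in
    (tens (wedge [tuple a; b]) (toSym c * w T)
     - tens (wedge [tuple a; c]) (toSym b * w T)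
     + tens (wedge [tuple b; c]) (toSym a * w T)).

Lemma incr_lt p (A : incr p n) (i j : 'I_p) : (i < j)%N -> (A i < A j)%N.
Proof.
by move=> lij; have /forallP/(_ i)/forallP/(_ j)/implyP := valP A; apply.
Qed.

Lemma incr_inj p (A : incr p n) : injective A.
Proof.
move=> i j eqA; apply: val_inj; apply/eqP.
by case: ltngtP => // /(incr_lt A); rewrite eqA ltnn.
Qed.

Lemma incr_image p (A B : incr p n) :
  (forall r, exists s, A s = B r) -> A = B.
Proof.
move=> hAB; apply/val_inj/ffunP => r; rewrite -[LHS]/(A r) -[RHS]/(B r).
have sorted_incr (C : incr p n) : sorted ltn [seq val (C i) | i <- enum 'I_p].
  rewrite (map_comp (val \o C) id) map_id sorted_map.
  have : sorted ltn (map val (enum 'I_p)) by rewrite val_enum_ord iota_ltn_sorted.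
  by rewrite sorted_map; apply: sub_sorted => i j; apply: incr_lt.
have eqAB : [seq val (A i) | i <- enum 'I_p] = [seq val (B i) | i <- enum 'I_p].
  apply: (irr_sorted_eq ltn_trans ltnn) (sorted_incr A) (sorted_incr B) _.
  have uB : uniq [seq val (B i) | i <- enum 'I_p].
    by rewrite map_inj_uniq ?enum_uniq // => i j /val_inj/incr_inj.
  have sBA : {subset [seq val (B i) | i <- enum 'I_p]
                <= [seq val (A i) | i <- enum 'I_p]}.
    move=> _ /mapP[i _ ->]; have [s <-] := hAB i.
    by apply/mapP; exists s; rewrite ?mem_enum.
  have [|_ eqi] := uniq_min_size uB sBA; first by rewrite !size_map.
  by move=> x; rewrite eqi.
apply: val_inj; have := congr1 (fun t => nth 0%N t r) eqAB.
by rewrite !(nth_map r) -?enumT ?size_enum_ord // !nth_ord_enum.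
Qed.

Lemma wedge_basis p (T : incr p n) :
  free e -> wedge [tuple tnth e (T r) | r < p] = ext_basis k T.
Proof.
move=> fe; apply/ffunP=> A; rewrite !ffunE.
have -> : (\matrix_(r < p, s < p)
             coord e (incr_fun A s)
                     (tnth [tuple tnth e (T r) | r < p] r))
          = \matrix_(r, s) (incr_fun A s == T r)%:R.
  apply/matrixP=> r s; rewrite !mxE tnth_mktuple (tnth_nth 0) coord_free //.
  by rewrite eq_sym.
have [-> | neAT] := eqVneq A T.
  transitivity (\det (1%:M : 'M[k]_p)); last by rewrite det1.
  congr (\det _); apply/matrixP=> r s.
  by rewrite !mxE (inj_eq (@incr_inj _ T)) eq_sym.
have [/forallP hr | ] := boolP [forall r, exists s, incr_fun A s == T r].
  case/eqP: neAT; apply: incr_image => r.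
  by have /existsP[s /eqP] := hr r; exists s.
rewrite negb_forall => /existsP[r]; rewrite negb_exists => /forallP hr.
by rewrite (expand_det_row _ r) big1 // => s _; rewrite mxE (negbTE (hr s)) mul0r.
Qed.

Lemma koszul_delta3_basis (T : incr 3 n) (f : {mpoly k[n]}) :
    let a := tnth e (T (inord 0)) in
    let b := tnth e (T (inord 1)) in
    let c := tnth e (T (inord 2)) in
  koszul_delta3 (tens (ext_basis k T) f)
  = tens (wedge [tuple a; b]) (toSym c * f)
    - tens (wedge [tuple a; c]) (toSym b * f)
    + tens (wedge [tuple b; c]) (toSym a * f).
Proof.
have tens0 (w : ext k 2) : tens w 0 = 0 by apply/ffunP=> A; rewrite !ffunE mulr0.
have tensE (A : incr 3 n) : tens (ext_basis k T) f A = (A == T)%:R * f.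
  by rewrite !ffunE -[LHS]/(_%:MP * f) rmorph_nat.
rewrite /koszul_delta3 (bigD1 T) //= [X in _ + X]big1 => [|A /negbTE neAT].
  by rewrite addr0 tensE (eqxx T) mul1r.
by rewrite !tensE neAT mul0r !mulr0 !tens0 subrr addr0.
Qed.

End Exterior.

Section Quotient.

Variables (k : fieldType) (n p : nat) (K : {vspace ext n k p}).

(* The quotient of the exterior power by K, identified with k^m through the
   isomorphic image of the basis [vbasis K^C] of a complement of K. *)
Definition quo_dim : nat := \dim (K^C)%VS.

Definition quo (u : ext n k p) : 'cV[k]_quo_dim :=
  \col_r coord (vbasis (K^C)%VS) r (u - projv K u).

Lemma quo_linear : linear quo.
Proof.
move=> a u v; apply/colP=> r; rewrite !mxE -linearP; congr (coord _ r _).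
by rewrite linearP scalerBr opprD addrACA.
Qed.

Lemma quo_eq0 u : (quo u == 0) = (u \in K).
Proof.
apply/eqP/idP=> [h | uK].
- have hC := memv_projC K u; have := coord_vbasis hC.
  rewrite big1 => [/eqP | i _]; last first.
    by move/colP/(_ i): h; rewrite !mxE => ->; rewrite scale0r.
  by rewrite subr_eq0 => /eqP ->; exact: memv_proj.
- by apply/colP=> r; rewrite !mxE projv_id // subrr linear0.
Qed.

Lemma quo_surj (y : 'cV[k]_quo_dim) : exists u, quo u = y.
Proof.
pose u := \sum_i y i 0 *: (vbasis (K^C)%VS)`_i.
have uC : u \in (K^C)%VS.
  apply: memv_suml => i _; apply: rpredZ; apply: vbasis_mem.
  by rewrite mem_nth ?size_tuple.
exists u; apply/colP=> r; rewrite mxE.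
have -> : projv K u = 0 by apply/eqP; rewrite -memv_ker lker_proj.
rewrite subr0 coord_sum_free //; exact: basis_free (vbasisP _).
Qed.

(* The base change of [quo] to S. *)
Definition quoS (w : ext n {mpoly k[n]} p) : 'cV[{mpoly k[n]}]_quo_dim :=
  \sum_(A : incr p n)
    (w A : {mpoly k[n]}) *: map_mx (@mpolyC n k) (quo (ext_basis k A)).

End Quotient.

Section Ideals.

Variable R : comNzRingType.

Definition ideal_gen (I : finType) (g : I -> R) (f : R) : Prop :=
  exists c : I -> R, f = \sum_i c i * g i.

Definition radical_ideal (J : R -> Prop) : Prop :=
  forall (f : R) (m : nat), J (f ^+ m) -> J f.

(* The 0-th Fitting ideal of the cokernel of M : R^q -> R^m (acting on column
   vectors): it is generated by the m x m minors of M. *)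
Definition Fitt0 m q (M : 'M[R]_(m, q)) : R -> Prop :=
  ideal_gen (fun g : incr m q => \det (colsub g M)).

End Ideals.

Section KoszulModule.

Variables (k : fieldType) (n : nat) (V : vectType k) (e : n.-tuple V).

(* The presentation matrix of the Koszul module W(V, K), that is, the matrix
   of the composite of koszul_delta3 with the projection modulo K. *)
Definition koszul_mx (K : {vspace ext n k 2}) :
    'M[{mpoly k[n]}]_(quo_dim K, #|{: incr 3 n}|) :=
  \matrix_(r, c)
    quoS K (koszul_delta3 e (ext_basis {mpoly k[n]} (enum_val c))) r 0.

Definition graph_vspace (E : rel 'I_n) : {vspace ext n k 2} :=
  (\sum_(i < n) \sum_(j < n | E i j)
     <[wedge e [tuple tnth e i; tnth e j]]>)%VS.

Definition koszul_fitt0 (E : rel 'I_n) : {mpoly k[n]} -> Prop :=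
  Fitt0 (koszul_mx (graph_vspace E)).

End KoszulModule.

Section Graphs.

Definition graph_iso (T U : Type) (E : rel T) (F : rel U) : Prop :=
  exists2 f : T -> U, bijective f & forall x y, F (f x) (f y) = E x y.

Definition connected_graph (T : finType) (E : rel T) : Prop :=
  forall x y, connect E x y.

Definition complete_graph (T : eqType) : rel T := fun x y => x != y.

Definition remove_edge (T : eqType) (E : rel T) (a b : T) : rel T :=
  fun x y => E x y && ~~ ((x == a) && (y == b) || (x == b) && (y == a)).

(* To be used with 3 <= m only. *)
Definition cycle_graph (m : nat) : rel 'I_m :=
  fun i j => (j == i.+1 %% m :> nat)%N || (i == j.+1 %% m :> nat)%N.

End Graphs.

(* Main.v *)
Require Import Defs.
From HB Require Import structures.
From mathcomp Require Import all_boot all_order all_algebra all_fingroup.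
From mathcomp Require Import ring zify.
From mathcomp Require Import mpoly.

(* After a change of basis, the presentation matrix has one row for each
   non-edge A of the graph E and one column for each triple T of vertices; its
   entry is 0 unless T = A + {c}, in which case it is X_c up to sign.  All its
   maximal minors are therefore homogeneous of degree m, the number of non-edges.
   A minor whose columns A + {c(A)} are triangular for some ranking of the
   non-edges puts the monomial prod_A X_c(A) in the Fitting ideal.

   If E is disconnected, the rows satisfy a linear relation and the ideal is 0.
   If any two non-edges are complementary subsets of the vertices, every choice
   c(A) outside A gives a diagonal minor with distinct c(A), and the ideal is
   generated by these square-free monomials.

   Conversely let E be connected with a radical Fitting ideal, and root a
   breadth-first spanning tree at a vertex v.  Choosing for c(A) the parent of
   the deeper vertex of A gives a triangular minor, ranked by the sum of the two
   depths.  The variables that occur are X_v and X_c(A) for the non-edges A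
   through v, since all the neighbours of v have v as parent; so the product of
   these variables is in the ideal, and m is at most 1 plus the number of
   non-edges through v.  Hence any two non-edges cover all the vertices, which
   for a connected graph leaves only K_n, K_n minus an edge and C_4. *)

Set Implicit Arguments.
Unset Strict Implicit.
Unset Printing Implicit Defensive.

(** * Determinants, maximal minors and Fitting ideals *)

Section Minors.

Import GRing.Theory.
Local Open Scope ring_scope.

(** In the Leibniz expansion, a permutation [s] whose term is not forced to vanish has
    [rho i < rho (s i)] at every moved point; since [s] preserves the sum of [rho], it moves
    nothing. Ties in [rho] are allowed. *)
Lemma det_triangular_rank (R : comNzRingType) m (M : 'M[R]_m) (rho : 'I_m -> nat) :
    (forall i j, i != j -> (rho j <= rho i)%N -> M i j = 0) ->
  \det M = \prod_i M i i.
Proof.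
move=> M0; rewrite /determinant (bigD1 1%g) //= odd_perm1 expr0 mul1r.
rewrite [X in _ + X]big1 ?addr0 => [|s s1].
  by apply: eq_bigr => i _; rewrite perm1.
have [/existsP[i /andP[si le_i]]|/existsPn le_rho] :=
    boolP [exists i, (s i != i) && (rho (s i) <= rho i)%N].
  by rewrite (bigD1 i) //= M0 ?mul0r ?mulr0 // eq_sym.
have rho_le i : (rho i <= rho (s i))%N.
  by have := le_rho i; case: eqP => [-> //|_ /=]; rewrite -ltnNge => /ltnW.
have [i si] : exists i, s i != i.
  apply/existsP; apply: contraR s1 => /existsPn s1.
  by apply/eqP/permP => i; rewrite perm1; apply/eqP; have /negbNE := s1 i.
have: (\sum_i rho i < \sum_i rho (s i))%N.
  rewrite [ltnLHS](bigD1 i) // [ltnRHS](bigD1 i) //= -addSn leq_add //; last exact: leq_sum.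
  by have := le_rho i; rewrite si /= -ltnNge.
by rewrite (reindex_perm s) ltnn.
Qed.

Lemma incr_of_set p n (X : {set 'I_n}) : #|X| = p ->
  exists A : incr p n, A @: setT = X.
Proof.
move=> cX; pose f := [ffun i : 'I_p => enum_val (cast_ord (esym cX) i)].
have fP : [forall i : 'I_p, forall j : 'I_p, (i < j)%N ==> (f i < f j)%N].
  apply/forallP=> i; apply/forallP=> j; apply/implyP=> lij; rewrite !ffunE.
  have sX : sorted (fun a b : 'I_n => (a < b)%N) (enum X).
    apply: sorted_filter => [a b c|]; first exact: ltn_trans.
    have: sorted ltn (map val (enum 'I_n)) by rewrite val_enum_ord iota_ltn_sorted.
    by rewrite sorted_map enumT.
  have x0 := enum_val (cast_ord (esym cX) i).
  rewrite !(enum_val_nth x0).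
  apply: (sorted_ltn_nth (leT := fun a b : 'I_n => (a < b)%N)) => //.
  - by move=> a b c; apply: ltn_trans.
  - by rewrite inE -cardE; apply: ltn_ord.
  - by rewrite inE -cardE; apply: ltn_ord.
exists (exist _ f fP); apply/setP=> x; apply/imsetP/idP => [[i _ ->]|xX].
  by rewrite /incr_fun /= ffunE enum_valP.
exists (cast_ord cX (enum_rank_in xX x)) => //.
by rewrite /incr_fun /= ffunE cast_ordK enum_rankK_in.
Qed.

Lemma incr_imset_inj p n (A B : incr p n) : A @: setT = B @: setT -> A = B.
Proof.
move=> eqAB; apply: incr_image => r.
have /imsetP[s _ ->] : B r \in A @: setT by rewrite eqAB imset_f.
by exists s.
Qed.

Lemma card_incr_imset p n (A : incr p n) : #|A @: setT| = p.
Proof. by rewrite card_imset ?cardsT ?card_ord //; apply: incr_inj. Qed.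

Lemma imset_incr2 n (A : incr 2 n) : A @: setT = [set A ord0; A ord_max].
Proof.
apply/setP=> x; apply/imsetP/set2P => [[i _ ->]|[] ->]; [|by exists ord0|by exists ord_max].
by case: i => [[|[|//]] i2]; [left|right]; congr (A _); apply: val_inj.
Qed.

Lemma ideal_gen0 (R : comNzRingType) (I : finType) (g : I -> R) : ideal_gen g 0.
Proof. by exists (fun=> 0); rewrite big1 // => i _; rewrite mul0r. Qed.

Lemma ideal_genD (R : comNzRingType) (I : finType) (g : I -> R) a b :
  ideal_gen g a -> ideal_gen g b -> ideal_gen g (a + b).
Proof.
move=> [c ->] [d ->]; exists (fun i => c i + d i).
by rewrite -big_split; apply: eq_bigr => i _; rewrite mulrDl.
Qed.

Lemma ideal_genM (R : comNzRingType) (I : finType) (g : I -> R) a b :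
  ideal_gen g b -> ideal_gen g (a * b).
Proof.
move=> [c ->]; exists (fun i => a * c i).
by rewrite mulr_sumr; apply: eq_bigr => i _; rewrite mulrA.
Qed.

Lemma ideal_gen_mem (R : comNzRingType) (I : finType) (g : I -> R) i :
  ideal_gen g (g i).
Proof.
exists (fun j => (j == i)%:R); rewrite (bigD1 i) //= eqxx mul1r big1 ?addr0 //.
by move=> j /negbTE ->; rewrite mul0r.
Qed.

Lemma ideal_gen_sub (R : comNzRingType) (I J : finType) (g : I -> R) (h : J -> R) a :
  (forall i, ideal_gen h (g i)) -> ideal_gen g a -> ideal_gen h a.
Proof.
move=> gh [c ->].
by apply: big_ind => [||i _]; [exact: ideal_gen0 | exact: ideal_genD | exact: ideal_genM].
Qed.

(** Columns need not be listed increasingly: a repeated column makes the minor 0, and sorting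
    distinct columns changes only its sign. *)
Lemma Fitt0_minor (R : comNzRingType) m q (M : 'M[R]_(m, q)) (g : 'I_m -> 'I_q) :
  Fitt0 M (\det (colsub g M)).
Proof.
have [/injectiveP ginj|/injectivePn[i [j neq_ij eqg]]] := boolP (injectiveb g); last first.
  rewrite -det_tr (determinant_alternate neq_ij); first exact: ideal_gen0.
  by move=> r; rewrite !mxE eqg.
have [|B imB] := @incr_of_set m q (g @: setT).
  by rewrite card_imset ?cardsT ?card_ord.
have gB i : exists j, g i == B j.
  have /imsetP[j _ ->] : g i \in B @: setT by rewrite imB imset_f.
  by exists j.
pose s i := xchoose (gB i); have gs i : g i = B (s i) by exact/eqP/(xchooseP (gB i)).
have sinj : injective s by move=> i j eqs; apply: ginj; rewrite !gs eqs.
have -> : \det (colsub g M) = (-1) ^+ perm sinj * \det (colsub B M).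
  have -> : colsub g M = col_perm (perm sinj) (colsub B M).
    by apply/matrixP=> i j; rewrite !mxE permE gs.
  by rewrite col_permE det_mulmx det_perm odd_permV mulrC.
by apply: ideal_genM; apply: (ideal_gen_mem (fun g : incr m q => \det (colsub g M))).
Qed.

(** Once [Q] is square, the minors of [Q *m M] are [\det Q] times those of [M]; writing [M] as
    [P *m (Q *m M)] gives the other inclusion. *)
Lemma Fitt0_unitmx_mul (R : comNzRingType) m s q (Q : 'M[R]_(m, s)) (P : 'M[R]_(s, m))
    (M : 'M[R]_(s, q)) a :
  m = s -> P *m Q = 1%:M -> Fitt0 (Q *m M) a <-> Fitt0 M a.
Proof.
move=> eqms; case: s / eqms Q P M => Q P M PQ.
have sub (X : 'M[R]_m) (Y : 'M[R]_(m, q)) : Fitt0 (X *m Y) a -> Fitt0 Y a.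
  apply: ideal_gen_sub => g.
  have -> : colsub (incr_fun g) (X *m Y) = X *m colsub (incr_fun g) Y.
    by apply/matrixP=> i j; rewrite !mxE; apply: eq_bigr => r _; rewrite !mxE.
  by rewrite det_mulmx; apply: ideal_genM; apply: Fitt0_minor.
by split; [exact: sub | rewrite -{1}[M]mul1mx -PQ -mulmxA; exact: sub].
Qed.

End Minors.

(** * The Koszul differential in coordinates and the presentation matrix of a graph *)

Section Koszul.

Import GRing.Theory.
Local Open Scope ring_scope.

Lemma face_subproof p n (T : incr p.+1 n) (i : 'I_p.+1) :
  let f := [ffun r : 'I_p => T (lift i r)] in
  [forall r : 'I_p, forall s : 'I_p, (r < s)%N ==> (f r < f s)%N].
Proof.
apply/forallP=> r; apply/forallP=> s; apply/implyP=> lrs; rewrite !ffunE.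
by apply: incr_lt; rewrite /= /bump; lia.
Qed.

Definition face p n (T : incr p.+1 n) (i : 'I_p.+1) : incr p n :=
  exist _ [ffun r : 'I_p => T (lift i r)] (face_subproof T i).

Lemma faceE p n (T : incr p.+1 n) i r : face T i r = T (lift i r).
Proof. by rewrite /incr_fun /= ffunE. Qed.

Lemma imset_face p n (T : incr p.+1 n) i :
  face T i @: setT = (T @: setT) :\ T i.
Proof.
apply/setP=> x; rewrite !inE; apply/imsetP/andP => [[r _ ->]|[xTi /imsetP[s _ xE]]].
  by rewrite faceE (inj_eq (@incr_inj _ _ T)) eq_sym neq_lift imset_f.
rewrite xE in xTi *; have /unlift_some[r sE _] : i != s by apply: contraNneq xTi => ->.
by exists r; rewrite // faceE sE.
Qed.

(** The coefficient of [e_B] in the Koszul differential of [e_T]. The faces of [T] are distinct, so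
    at most one term is nonzero. *)
Definition koszul_coef (k : fieldType) n (B : incr 2 n) (T : incr 3 n) : {mpoly k[n]} :=
  \sum_(i < 3) (-1) ^+ i * (B == face T i)%:R * 'X_(T i).

Lemma koszul_coef_face k n (T : incr 3 n) (i : 'I_3) :
  koszul_coef k (face T i) T = (-1) ^+ i * 'X_(T i).
Proof.
rewrite /koszul_coef (bigD1 i) //= eqxx mulr1 big1 ?addr0 // => j neq_ji.
rewrite [_ == _](_ : _ = false) ?mulr0 ?mul0r //;
apply/negP => /eqP/(congr1 (fun A : incr 2 n => A @: setT)).
rewrite !imset_face => /setP/(_ (T i)); rewrite !inE eqxx (inj_eq (@incr_inj _ _ T)) eq_sym neq_ji.
by rewrite imset_f.
Qed.

Lemma koszul_coef_out k n (B : incr 2 n) (T : incr 3 n) :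
  ~~ (B @: setT \subset T @: setT) -> koszul_coef k B T = 0.
Proof.
move=> BT; rewrite /koszul_coef big1 // => i _.
case: eqP => [BE|_]; last by rewrite mulr0 mul0r.
by case/negP: BT; rewrite BE imset_face subsetDl.
Qed.

Lemma koszul_coef_in k n (B : incr 2 n) (T : incr 3 n) c :
    c \notin B @: setT -> T @: setT = c |: (B @: setT) ->
  exists b : nat, koszul_coef k B T = (-1) ^+ b * 'X_c.
Proof.
move=> cB TE; have /imsetP[i _ ci] : c \in T @: setT by rewrite TE setU11.
have -> : B = face T i by apply: incr_imset_inj; rewrite imset_face TE -ci setU1K.
by exists i; rewrite koszul_coef_face ci.
Qed.

Lemma koszul_coef_cases k n (B : incr 2 n) (T : incr 3 n) :
  koszul_coef k B T = 0 \/
  exists2 c, c \notin B @: setT & exists b : nat, koszul_coef k B T = (-1) ^+ b * 'X_c.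
Proof.
have [BT|/(koszul_coef_out k)] := boolP (B @: setT \subset T @: setT); last by left.
right; have : #|(T @: setT) :\: (B @: setT)| == 1%N.
  by rewrite cardsDS // !card_incr_imset.
case/cards1P => c cE; have : c \in (T @: setT) :\: (B @: setT) by rewrite cE set11.
rewrite inE => /andP[cB cT]; exists c => //; apply: koszul_coef_in => //.
by rewrite -cE setUC setDE setUIr setUCr setIT; apply/esym/setUidPr.
Qed.

Variables (k : fieldType) (n : nat) (V : vectType k) (e : n.-tuple V).
Hypothesis he : basis_of fullv e.

Lemma koszul_delta3_coef (T : incr 3 n) (B : incr 2 n) :
  koszul_delta3 e (ext_basis {mpoly k[n]} T) B = koszul_coef k B T.
Proof.
have fe : free e := basis_free he.
have symE i : toSym e (tnth e i) = 'X_i.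
  rewrite /toSym (bigD1 i) //= (tnth_nth 0) coord_free // eqxx scale1r big1 ?addr0 // => j ji.
  by rewrite coord_free // eq_sym (negbTE ji) scale0r.
(* The wedge of two of the three vectors is the basis vector of the face omitting the third. *)
have wE (i r s : 'I_3) : lift i ord0 = r -> lift i ord_max = s ->
    wedge e [tuple tnth e (T r); tnth e (T s)] = ext_basis k (face T i).
  move=> <- <-; rewrite -(wedge_basis (face T i) fe); congr (wedge e _); apply: eq_from_tnth => j.
  rewrite tnth_mktuple faceE; case: j => [[|[|//]] jP]; rewrite (tnth_nth 0) /=;
    by congr (tnth e (T (lift i _))); apply: val_inj.
have -> : ext_basis {mpoly k[n]} T = tens (ext_basis k T) 1.
  by apply/ffunP=> A; rewrite !ffunE mulr1 -[RHS]/(_%:MP) rmorph_nat.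
rewrite koszul_delta3_basis // !symE.
rewrite (@wE (inord 2)); try by apply: val_inj; rewrite /= /bump !inordK.
rewrite (@wE (inord 1)); try by apply: val_inj; rewrite /= /bump !inordK.
rewrite (@wE (inord 0)); try by apply: val_inj; rewrite /= /bump !inordK.
rewrite !ffunE /koszul_coef !big_ord_recl big_ord0 !mulr1.
have -> : ord0 = inord 0 :> 'I_3 by apply: val_inj; rewrite /= inordK.
have -> : lift (inord 0) ord0 = inord 1 :> 'I_3 by apply: val_inj; rewrite /= /bump !inordK.
have -> : lift (inord 0) (lift ord0 ord0) = inord 2 :> 'I_3.
  by apply: val_inj; rewrite /= /bump !inordK.
rewrite !inordK //; set b0 := B == _; set b1 := B == _; set b2 := B == _.
have mE (b : bool) : (b%:R : k)%:MP = b%:R :> {mpoly k[n]} by rewrite rmorph_nat.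
rewrite -[LHS]/(b0%:R%:MP * 'X_(T (inord 2))
               - b1%:R%:MP * 'X_(T (inord 1))
               + b2%:R%:MP * 'X_(T (inord 0))).
rewrite !mE; ring.
Qed.

(** The Koszul differential followed by the coordinate projection onto the [e_A] with [A] in [N]; it
    will be used with [N] the set of non-edges. *)
Definition koszul_rows (N : {set incr 2 n}) : 'M[{mpoly k[n]}]_(#|N|, #|{: incr 3 n}|) :=
  \matrix_(r, c) koszul_coef k (enum_val r) (enum_val c).

Variable E : rel 'I_n.

(* An element of [incr 2 n] encodes a pair of vertices, listed increasingly. *)
Definition nonedges : {set incr 2 n} := [set A : incr 2 n | ~~ E (A ord0) (A ord_max)].

Lemma graph_vspace_edge (A : incr 2 n) :
  A \notin nonedges -> ext_basis k A \in graph_vspace e E.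
Proof.
rewrite inE negbK => EA; rewrite -(wedge_basis A (basis_free he)).
have -> : [tuple tnth e (A r) | r < 2] = [tuple tnth e (A ord0); tnth e (A ord_max)].
  apply: eq_from_tnth => j.
  rewrite tnth_mktuple; case: j => [[|[|//]] jP]; rewrite [RHS](tnth_nth 0) /=;
    by congr (tnth e (A _)); apply: val_inj.
rewrite /graph_vspace (bigD1 (A ord0)) //= (bigD1 (A ord_max)) //=.
by rewrite -addvA; apply: (subvP (addvSl _ _)); apply: memv_line.
Qed.

Hypothesis hsym : ssrbool.symmetric E.

(** The coordinate at [A] is a linear form, so it is enough to evaluate it on the generators of the
    subspace; symmetry of [E] settles those with [j < i]. *)
Lemma graph_vspace_nonedge (u : ext n k 2) (A : incr 2 n) :
  u \in graph_vspace e E -> A \in nonedges -> u A = 0.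
Proof.
rewrite inE => uK NA.
pose ev (u : ext n k 2) : k^o := u A.
have ev_lin : linear ev by move=> a x y; rewrite /ev !ffunE.
pose evm := GRing.isLinear.Build _ _ _ _ ev ev_lin.
pose evL : {linear ext n k 2 -> k^o} := HB.pack ev evm.
suff /subvP/(_ _ uK) : (graph_vspace e E <= lker (linfun evL))%VS.
  by rewrite memv_ker lfunE => /eqP.
apply/subv_sumP => i _; apply/subv_sumP => j Eij; rewrite -memvE memv_ker lfunE /=.
rewrite /ev ffunE (expand_det_row _ ord0) !big_ord_recl big_ord0 /cofactor !det_mx11 !mxE.
have -> : lift (lift ord0 ord0) 0 = ord0 :> 'I_2 by apply: val_inj.
have -> : lift ord0 0 = ord_max :> 'I_2 by apply: val_inj.
have coordE a b : coord e a (tnth e b) = (a == b)%:R.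
  by rewrite (tnth_nth 0) coord_free ?(basis_free he) // eq_sym.
rewrite -[tnth _ ord0]/(tnth e i) -[tnth _ ord_max]/(tnth e j) !coordE.
have lt01 : ((ord0 : 'I_2) < (ord_max : 'I_2))%N by [].
have [Ai|_] := eqVneq (A ord0) i; have [Aj|_] := eqVneq (A ord_max) j.
- by rewrite Ai Aj Eij in NA.
- have [Ai'|_] := eqVneq (A ord_max) i; last by rewrite /= ?(mulr0n, mulr0, mul0r, addr0).
  by have := incr_lt A lt01; rewrite Ai Ai' ltnn.
- have [Aj'|_] := eqVneq (A ord0) j; last by rewrite /= ?(mulr0n, mulr0, mul0r, addr0).
  by have := incr_lt A lt01; rewrite Aj Aj' ltnn.
have [Ai'|_] := eqVneq (A ord_max) i; last by rewrite /= ?(mulr0n, mulr0, mul0r, addr0).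
have [Aj'|_] := eqVneq (A ord0) j; last by rewrite /= ?(mulr0n, mulr0, mul0r, addr0).
by rewrite Ai' Aj' hsym Eij in NA.
Qed.

Lemma quo_injective_nonedges (y : ext n k 2) :
    (forall A, A \notin nonedges -> y A = 0) ->
  quo (graph_vspace e E) y = 0 -> y = 0.
Proof.
move=> y0 /eqP; rewrite quo_eq0 => yK; apply/ffunP => A; rewrite [RHS]ffunE.
by have [/(graph_vspace_nonedge yK)|/y0] := boolP (A \in nonedges).
Qed.

(** The classes of the [e_A], for [A] a non-edge, form a basis of the quotient. The matrix [Q]
    expresses them in the basis used by [quo], so it is invertible, and the two presentation
    matrices differ by the left factor [Q]. *)
Lemma koszul_fitt0_rows a : koszul_fitt0 e E a <-> Fitt0 (koszul_rows nonedges) a.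
Proof.
set K := graph_vspace e E.
pose Q : 'M[k]_(quo_dim K, #|nonedges|) :=
  \matrix_(r, c) quo K (ext_basis k (enum_val c)) r 0.
have extE (u : ext n k 2) : u = \sum_A (u A : k) *: ext_basis k A.
  apply/ffunP=> B; rewrite sum_ffunE (bigD1 B) //= !ffunE eqxx big1 ?addr0.
    by rewrite -[RHS]/(_ * 1) mulr1.
  by move=> A /negbTE AB; rewrite !ffunE eq_sym AB -[LHS]/(_ * 0) mulr0.
have quo_sum (I : finType) (c : I -> k) (w : I -> ext n k 2) :
    quo K (\sum_i c i *: w i) = \sum_i c i *: quo K (w i).
  have lin := @quo_linear k n 2 K.
  have q0 : quo K 0 = 0 by apply/eqP; rewrite quo_eq0 mem0v.
  apply: (big_ind2 (fun x y => quo K x = y)) => // [x1 x2 y1 y2 <- <-|i _].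
    by have := lin 1 x1 y1; rewrite !scale1r.
  by have := lin (c i) (w i) 0; rewrite q0 !addr0.
have mulQ (v : 'rV_(quo_dim K)) (u : ext n k 2) : v *m Q = 0 -> v *m quo K u = 0.
  move=> vQ; rewrite [u]extE quo_sum mulmx_sumr big1 // => A _; rewrite -scalemxAr.
  have [NA|/graph_vspace_edge] := boolP (A \in nonedges); last first.
    by rewrite -/K -quo_eq0 => /eqP ->; rewrite mulmx0 scaler0.
  rewrite [v *m _](_ : _ = 0) ?scaler0 //; apply/matrixP=> i j; rewrite !mxE.
  have /matrixP/(_ i (enum_rank_in NA A)) := vQ; rewrite !mxE => {2}<-.
  by apply: eq_bigr => r _; rewrite !mxE enum_rankK_in // (ord1 j).
(* A row vector killing the columns of [Q] kills the whole image of [quo], which is everything. *)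
have /eqP Qm : row_free Q.
  apply: inj_row_free => v /mulQ vQ; apply/rowP=> r; rewrite [RHS]mxE.
  have [u uE] := quo_surj (delta_mx r 0 : 'cV_(quo_dim K)).
  have /matrixP/(_ 0 0) := vQ u; rewrite uE mxE (bigD1 r) //= !mxE !eqxx mulr1 big1 ?addr0 //.
  by move=> i /negbTE ir; rewrite !mxE ir mulr0.
(* A relation between the columns of [Q] gives an element of [K] supported on non-edges, hence 0. *)
have Qs : row_full Q.
  rewrite /row_full -mxrank_tr; apply: inj_row_free => z Qz.
  pose y : ext n k 2 := \sum_(i < #|nonedges|) z 0 i *: ext_basis k (enum_val i).
  have yE i : y (enum_val i) = z 0 i.
    rewrite /y sum_ffunE (bigD1 i) //= !ffunE eqxx big1 ?addr0 => [|j ji].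
      by rewrite -[LHS]/(_ * 1) mulr1.
    by rewrite !ffunE (inj_eq enum_val_inj) eq_sym (negbTE ji) -[LHS]/(_ * 0) mulr0.
  have y0 : y = 0.
    apply: quo_injective_nonedges => [A NA|].
      rewrite /y sum_ffunE big1 // => i _; rewrite !ffunE.
      case: eqP NA => [->|_ _]; first by rewrite enum_valP.
      by rewrite -[LHS]/(_ * 0) mulr0.
    rewrite quo_sum; apply/colP=> r; rewrite summxE [RHS]mxE.
    have /matrixP/(_ 0 r) := Qz; rewrite !mxE => {2}<-.
    by apply: eq_bigr => i _; rewrite !mxE.
  by apply/rowP=> i; rewrite -yE y0 !ffunE mxE.
have eqd : quo_dim K = #|nonedges| by rewrite -Qm; apply/eqP.
have [P PQ] := row_fullP Qs.
have -> : koszul_fitt0 e E a = Fitt0 (map_mx (@mpolyC n k) Q *m koszul_rows nonedges) a.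
  rewrite /koszul_fitt0; congr (Fitt0 _ a); apply/matrixP=> r c; rewrite !mxE.
  rewrite /quoS summxE (bigID (fun A => A \in nonedges)) /= [X in _ + X]big1 => [|A NA]; last first.
    have /graph_vspace_edge := NA; rewrite -quo_eq0 => /eqP qA.
    by rewrite mxE [X in _ * X]mxE qA mxE rmorph0 mulr0.
  rewrite addr0 big_enum_val; apply: eq_bigr => i _.
  by rewrite !mxE koszul_delta3_coef mulrC.
apply: (@Fitt0_unitmx_mul _ _ _ _ _ (map_mx (@mpolyC n k) P)) => //.
by rewrite -map_mxM PQ map_mx1.
Qed.

End Koszul.

(** * The Fitting ideal of the rows: monomials, vanishing, degree and radicality *)

Section Fitting.

Import GRing.Theory.
Local Open Scope ring_scope.

Variables (k : fieldType) (n : nat).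
Implicit Types (N : {set incr 2 n}) (A B : incr 2 n) (c : incr 2 n -> 'I_n).

(** The column chosen for [A] is the triple formed by [A] and [c A]. Its entry in row [A] is
    ['X_(c A)] up to sign, and a nonzero entry in another row [B] requires [B] inside the triple,
    hence [rho B < rho A]: the minor is triangular. *)
Lemma koszul_rows_prod N c (rho : incr 2 n -> nat) :
    (forall A, A \in N -> c A \notin A @: setT) ->
    (forall A B, A \in N -> B \in N -> B != A ->
       B @: setT \subset c A |: (A @: setT) -> (rho B < rho A)%N) ->
  Fitt0 (koszul_rows k N) (\prod_(A in N) 'X_(c A)).
Proof.
move=> cA ltrho.
have Tex (r : 'I_#|N|) : exists T : incr 3 n,
    T @: setT == c (enum_val r) |: (enum_val r : incr 2 n) @: setT.
  have [|T TE] := @incr_of_set 3 n (c (enum_val r) |: (enum_val r : incr 2 n) @: setT).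
    by rewrite cardsU1 cA ?enum_valP // card_incr_imset.
  by exists T; apply/eqP.
pose T r : incr 3 n := xchoose (Tex r).
have TE r : T r @: setT = c (enum_val r) |: (enum_val r : incr 2 n) @: setT.
  exact/eqP/(xchooseP (Tex r)).
have diag r := koszul_coef_in k (cA _ (enum_valP r)) (TE r).
have [b bE] : exists b : nat, \prod_(r < #|N|) koszul_coef k (enum_val r) (T r)
    = (-1) ^+ b * \prod_(A in N) 'X_(c A).
  have -> : \prod_(A in N) 'X_(c A) = \prod_(r < #|N|) 'X_(c (enum_val r)) :> {mpoly k[n]}.
    by rewrite [LHS]big_enum_val.
  elim/big_rec2: _ => [|r x y _ [b ->]].
    by exists 0%N; rewrite mul1r.
  by have [d ->] := diag r; exists (d + b)%N; rewrite exprD; ring.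
pose g r := enum_rank (T r).
have detE : \det (colsub g (koszul_rows k N)) = (-1) ^+ b * \prod_(A in N) 'X_(c A).
  rewrite -bE (@det_triangular_rank _ _ _ (fun r => rho (enum_val r))) => [|i j neq_ij rho_ji].
    by apply: eq_bigr => r _; rewrite !mxE enum_rankK.
  rewrite !mxE enum_rankK; apply: koszul_coef_out; rewrite TE.
  apply: contraL rho_ji => BT; rewrite -ltnNge; apply: ltrho BT; rewrite ?enum_valP //.
  by rewrite (inj_eq enum_val_inj).
have := ideal_genM ((-1) ^+ b) (Fitt0_minor (koszul_rows k N) g).
by rewrite detE mulrA -expr2 sqrr_sign mul1r.
Qed.

Lemma koszul_rows_disconnected (E : rel 'I_n) x y a :
  ~~ connect E x y -> ssrbool.symmetric E -> Fitt0 (koszul_rows k (nonedges E)) a -> a = 0.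
Proof.
move=> nxy hsym [c ->]; rewrite big1 // => g _.
suff -> : \det (colsub (incr_fun g) (koszul_rows k (nonedges E))) = 0 by rewrite mulr0.
(* w is x /\ y, where y is the restriction of the generic point x = (X_i)_i to a
   connected component. *)
pose ind i : {mpoly k[n]} := (connect E x i)%:R.
pose w A : {mpoly k[n]} := 'X_(A ord0) * 'X_(A ord_max) * (ind (A ord_max) - ind (A ord0)).
have w_edge A : A \notin nonedges E -> w A = 0.
  rewrite inE negbK => EA; rewrite /w /ind.
  by rewrite (same_connect_r (sym_connect_sym hsym) (connect1 EA)) subrr mulr0.
(* By Laplace expansion, this sum is the coefficient at [e_T] of the generic point wedged with [w],
   a product with a repeated factor. *)
have wT T : \sum_A w A * koszul_coef k A T = 0.
  transitivity (\sum_(i < 3) (-1) ^+ i * 'X_(T i) * w (face T i)).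
    rewrite /koszul_coef; under eq_bigr => A _ do rewrite mulr_sumr.
    rewrite exchange_big /=; apply: eq_bigr => i _.
    rewrite (bigD1 (face T i)) //= eqxx big1 ?addr0 => [|A /negbTE ->].
      by rewrite mulr1 mulrC.
    by rewrite mulr0 mul0r mulr0.
  rewrite !big_ord_recl big_ord0 /w !faceE.
  have l (i : 'I_3) (r : 'I_2) (j : 'I_3) : bump i r = j -> lift i r = j.
    by move=> ?; apply: val_inj.
  rewrite (l ord0 (lift ord0 ord0) (inord 2)) ?(l ord0 ord0 (inord 1)) ?inordK //.
  rewrite (l ord0 ord_max (inord 2)) ?(l (inord 1) ord0 ord0) ?(l (inord 1) ord_max (inord 2));
    try by rewrite /= ?inordK.
  rewrite (l (inord 2) ord0 ord0) ?(l (inord 2) ord_max (inord 1)); try by rewrite /= ?inordK.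
  by ring.
(* As [w] vanishes on edges, its restriction to the non-edges still kills every column. Its entry at
   the non-edge formed by [x] and [y] is nonzero. *)
apply/eqP/det0P; exists (\row_r w (enum_val r)).
  have neq_xy : x != y by apply: contraNneq nxy => ->.
  have [|A imA] := @incr_of_set 2 n [set x; y]; first by rewrite cards2 neq_xy.
  have Axy i : (A i == x) || (A i == y) by rewrite -in_set2 -imA imset_f.
  have A01 : A ord0 != A ord_max by rewrite (inj_eq (@incr_inj _ _ A)).
  have nyx : ~~ connect E y x by rewrite sym_connect_sym.
  have NA : A \in nonedges E.
    rewrite inE; apply: contra nxy => EA; have EA' := EA; rewrite hsym in EA'.
    move: EA EA' A01; case/pred2P: (Axy ord0) => ->; case/pred2P: (Axy ord_max) => ->;
      by rewrite ?eqxx // => *; apply: connect1.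
  apply/eqP => /rowP /(_ (enum_rank_in NA A)); rewrite !mxE enum_rankK_in // => /eqP; apply/negP.
  have X0 i : 'X_i != 0 :> {mpoly k[n]}.
    apply/eqP => /(congr1 (mcoeff U_(i))); rewrite mcoeffXU eqxx mcoeff0.
    by move/eqP; rewrite oner_eq0.
  rewrite mulf_neq0 ?mulf_neq0 //; move: A01.
  case/pred2P: (Axy ord0) => ->; case/pred2P: (Axy ord_max) => ->; rewrite ?eqxx // => _;
    by rewrite /ind connect0 (negbTE nxy) ?subr0 ?sub0r ?oppr_eq0 oner_neq0.
apply/rowP=> j; rewrite !mxE.
rewrite -[RHS](wT (enum_val (incr_fun g j))) [RHS](bigID (fun A => A \in nonedges E)) /=.
rewrite [X in _ + X]big1 => [|A /w_edge ->]; last by rewrite mul0r.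
by rewrite addr0 [RHS]big_enum_val; apply: eq_bigr => r _; rewrite !mxE.
Qed.

Lemma koszul_rows_degree N (s : seq 'I_n) :
  Fitt0 (koszul_rows k N) (\prod_(i <- s) 'X_i) -> (#|N| <= size s)%N.
Proof.
(* Substituting one variable 'X for all the X_i reads off the total degree. *)
pose phi : {rmorphism {mpoly k[n]} -> {poly k}} := mmap (@polyC k) (fun=> 'X).
have phiX i : phi 'X_i = 'X by rewrite /phi /= mmapX mmap1U.
case=> c /(congr1 phi); rewrite rmorph_prod (eq_bigr (fun=> 'X)) => [|i _]; last exact: phiX.
rewrite big_const_seq count_predT iter_mulr_1 => Xs.
have: ('X^#|N| %| ('X^(size s) : {poly k}))%R.
  rewrite Xs rmorph_sum /=; apply: (big_ind (fun p => 'X^#|N| %| p)%R) => [|p q|g _].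
  - exact: dvdp0.
  - exact: dvdp_add.
  rewrite rmorphM dvdp_mull // -det_map_mx.
  (* Every entry specializes to ['X] times a constant, and pulling ['X] out of each row gives the
     factor ['X^#|N|]. *)
  pose M : 'M[{poly k}]_#|N| := \matrix_(r, t) \sum_(i < 3) (-1) ^+ i *
    ((enum_val r == face (enum_val (incr_fun g t)) i)%:R : {poly k}).
  have -> : map_mx phi (colsub (incr_fun g) (koszul_rows k N)) = 'X *: M.
    apply/matrixP=> r t; rewrite !mxE rmorph_sum mulr_sumr; apply: eq_bigr => i _.
    by rewrite !rmorphM /= phiX rmorph_sign rmorph_nat mulrC.
  by rewrite detZ dvdp_mulr.
by move/dvdp_leq; rewrite !size_polyXn ltnS; apply; rewrite -size_poly_eq0 size_polyXn.
Qed.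

Lemma koszul_rows_monomial N a m A :
    Fitt0 (koszul_rows k N) (a ^+ m) -> A \in N ->
  forall u, u \in msupp a -> exists2 i, i \notin A @: setT & (0 < u i)%N.
Proof.
move=> am NA u ua; apply/exists_inP; apply: contraLR ua => /exists_inPn u0.
(* Setting X_i to 0 for i outside A kills the row A, hence every maximal minor. *)
pose h i : {mpoly k[n]} := if i \in A @: setT then 'X_i else 0.
pose phi : {rmorphism {mpoly k[n]} -> {mpoly k[n]}} := mmap (@mpolyC n k) h.
have phi_am : phi (a ^+ m) = 0.
  case: am => c ->; rewrite rmorph_sum big1 // => g _; rewrite rmorphM -det_map_mx.
  rewrite (expand_det_row _ (enum_rank_in NA A)) big1 ?mulr0 // => j _.
  rewrite !mxE enum_rankK_in //.
  have [->|[i iA [b ->]]] := koszul_coef_cases k A (enum_val (incr_fun g j)).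
    by rewrite rmorph0 mul0r.
  rewrite rmorphM /= mmapX mmap1U /h (negbTE iA) mulr0 mul0r //.
have phi_a : phi a = 0.
  by move/eqP: phi_am; rewrite rmorphXn expf_eq0 => /andP[_ /eqP].
rewrite mcoeff_msupp negbK; move/(congr1 (mcoeff u)): phi_a; rewrite mcoeff0 => phi_au.
have -> : a@_u = \sum_(v <- msupp a) a@_v * (v == u)%:R.
  by rewrite {1}[a]mpolyE raddf_sum; apply: eq_bigr => v _; rewrite /= mcoeffZ mcoeffX.
rewrite -[eqbRHS]phi_au; apply/eqP.
rewrite [in RHS](mpolyE a) rmorph_sum [RHS]raddf_sum; apply: eq_bigr => v _.
rewrite /= mmapZ mcoeffCM mmapX; congr (_ * _).
(* [phi] kills the monomials involving a variable outside [A] and fixes the others, among them [u];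
   so [a] and [phi a] have the same coefficient at [u]. *)
have [/exists_inP[i iA vi]|/exists_inPn v0] := boolP [exists i in ~: (A @: setT), (0 < v i)%N].
  rewrite /mmap1 (bigD1 i) //= {1}/h; rewrite inE in iA.
  rewrite (negbTE iA) expr0n -[v i == 0%N]negbK -lt0n vi mul0r mcoeff0.
  by case: eqP => // vu; have := u0 i iA; rewrite -vu vi.
rewrite -mcoeffX mpolyXE_id; congr mcoeff; apply: eq_bigr => i _; rewrite /h.
case: ifP => // /negbT iA; have := v0 i; rewrite inE => /(_ iA).
by rewrite lt0n negbK => /eqP ->.
Qed.

(** It suffices to treat each monomial [u] of [a]. For every [A] in [N], choose a variable of [u]
    outside [A]: disjointness makes the corresponding minor diagonal, and covering makes the choices
    distinct, so that their product divides the monomial. *)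
Lemma koszul_rows_radical N :
    (forall A B, A \in N -> B \in N -> A != B -> [disjoint A @: setT & B @: setT]) ->
    (forall A B i, A \in N -> B \in N -> A != B -> i \in A @: setT :|: B @: setT) ->
  radical_ideal (Fitt0 (koszul_rows k N)).
Proof.
move=> disj cover a m am; rewrite [a]mpolyE big_seq.
apply: big_ind => [||u ua]; [exact: ideal_gen0 | exact: ideal_genD |].
have cex A : exists i : 'I_n, (A \in N) ==> (i \notin A @: setT) && (0 < u i)%N.
  have [NA|_] := boolP (A \in N); last by exists (A ord0).
  by have [i iA ui] := koszul_rows_monomial am NA ua; exists i; rewrite iA.
pose c A := xchoose (cex A).
have cP A : A \in N -> (c A \notin A @: setT) && (0 < u (c A))%N.
  by move=> NA; apply: (implyP (xchooseP (cex A))).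
have cA A : A \in N -> c A \notin A @: setT by move=> /cP/andP[].
have prodJ : Fitt0 (koszul_rows k N) (\prod_(A in N) 'X_(c A)).
  (* A pair [B] disjoint from [A] but inside [c A |: A] would have [c A] as its only element, so no
     off-diagonal entry survives and a constant rank suffices. *)
  apply: (@koszul_rows_prod _ _ (fun=> 0%N)) => // A B NA NB BA.
  have /disjoint_setI0 := disj _ _ NB NA BA.
  move=> disjBA /subsetP sBA.
  have BE i : B i = c A.
    have iB : B i \in B @: setT by rewrite imset_f.
    have := sBA _ iB; rewrite !inE => /orP[/eqP//|iA].
    by have := in_set0 (B i); rewrite -disjBA inE iB iA.
  by have /incr_inj : B ord0 = B ord_max by rewrite !BE.
have cinj A B : A \in N -> B \in N -> c A = c B -> A = B.
  move=> NA NB eqc; apply/eqP; apply: contraTT isT => AB.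
  have := cover A B (c A) NA NB AB; rewrite inE (negbTE (cA A NA)) /= eqc.
  by rewrite (negbTE (cA B NB)).
pose v := (\sum_(A in N) U_(c A))%MM.
have vu : (v <= u)%MM.
  apply/mnm_lepP => i; rewrite mnm_sumE.
  have [/exists_inP[A NA /eqP Ai]|/exists_inPn nA] := boolP [exists A in N, c A == i].
    rewrite (bigD1 A) //= mnm1E Ai eqxx big1 ?addn0 => [|B /andP[NB BA]].
      by rewrite -Ai; have /andP[] := cP A NA.
    rewrite mnm1E; case: eqP => // Bi; case/eqP: BA; apply: cinj => //.
    by rewrite Ai.
  by rewrite big1 // => A NA; rewrite mnm1E (negbTE (nA A NA)).
rewrite -(submK vu) mpolyXD -mul_mpolyC mulrA; apply: ideal_genM.
rewrite (_ : 'X_[v] = \prod_(A in N) 'X_(c A)) //.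
by rewrite /v; elim/big_rec2: _ => [|A p q _ <-]; rewrite ?mpolyX0 ?mpolyXD.
Qed.

End Fitting.

(** * Breadth-first trees and the bound on the number of non-edges *)

Section Graph.

(** [d] is the distance from [v], and [p] takes a predecessor on a shortest walk. The last clause is
    what later bounds the number of distinct parents. *)
Lemma connected_parent (T : finType) (E : rel T) (v : T) :
    (forall x, connect E v x) ->
  exists (d : T -> nat) (p : T -> T),
    [/\ d v = 0,
        forall w, w != v -> E (p w) w && (d (p w) < d w)
      & forall w, w != v -> E v w -> p w = v].
Proof.
move=> vE.
pose walk x m := [exists q : m.-tuple T, path E v q && (last v q == x)].
have walkP x q : path E v q -> last v q = x -> walk x (size q).
  by move=> vq qx; apply/existsP; exists (in_tuple q); rewrite vq qx eqxx.
have wex x : exists m, walk x m.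
  by have /connectP[q vq qx] := vE x; exists (size q); apply: walkP.
pose d x := ex_minn (wex x).
have dv : d v = 0.
  by rewrite /d; case: ex_minnP => m _ /(_ 0); rewrite leqn0 => /(_ (walkP v [::] isT erefl))/eqP.
have pex (w : T) : exists u : T, ((w != v) ==> [&& E u w, d u < d w & (E v w) ==> (u == v)])%B.
  have [->|neq_wv] := eqVneq w v; first by exists v.
  have [q [vq qw sq]] : exists q, [/\ path E v q, last v q = w & size q = d w].
    rewrite /d; case: ex_minnP => m /existsP[q /andP[vq /eqP qw]] _.
    by exists q; rewrite size_tuple.
  case/lastP: q vq qw sq => [|q z]; first by move=> _ /= vw; rewrite vw eqxx in neq_wv.
  rewrite rcons_path last_rcons size_rcons => /andP[vq Ez] zw sq; rewrite {z}zw in Ez.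
  have [Evw|nEvw] := boolP (E v w).
    by exists v; rewrite Evw eqxx dv -sq.
  exists (last v q); rewrite Ez /= andbT -sq ltnS /d.
  by case: ex_minnP => m _; apply; apply: walkP.
exists d, (fun w => xchoose (pex w)); split=> // w wv.
  by have /implyP/(_ wv)/and3P[-> ->] := xchooseP (pex w).
by have /implyP/(_ wv)/and3P[_ _ /implyP pv] := xchooseP (pex w); move=> /pv/eqP.
Qed.

Variables (n : nat) (E : rel 'I_n).
Hypotheses (hsym : ssrbool.symmetric E).

Lemma nonedges_imset (A : incr 2 n) x y :
  A @: setT = [set x; y] -> (A \in nonedges E) = ~~ E x y.
Proof.
move=> imA; rewrite inE.
have Axy i : (A i == x) || (A i == y) by rewrite -in_set2 -imA imset_f.
have A01 : A ord0 != A ord_max by rewrite (inj_eq (@incr_inj _ _ A)).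
have xA : x \in [set A ord0; A ord_max] by rewrite -imset_incr2 imA set21.
have yA : y \in [set A ord0; A ord_max] by rewrite -imset_incr2 imA set22.
move: A01 xA yA; rewrite !inE.
case/pred2P: (Axy ord0) => ->; case/pred2P: (Axy ord_max) => ->; rewrite ?eqxx // => neq.
by rewrite hsym.
Qed.

Lemma exists_nonedge x y : x != y -> ~~ E x y ->
  exists2 A : incr 2 n, A \in nonedges E & A @: setT = [set x; y].
Proof.
move=> xy nE; have [|A imA] := @incr_of_set 2 n [set x; y]; first by rewrite cards2 xy.
by exists A; rewrite ?(nonedges_imset imA).
Qed.

Import GRing.Theory.
Local Open Scope ring_scope.

(** If [v] lay outside [P] and [Q], there would be at least [#|Nv| + 2] non-edges, whereas the tree
    rooted at [v] puts a product of [#|Nv| + 1] variables in the radical ideal. *)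
Lemma radical_nonedges_cover (k : fieldType) (v : 'I_n) (P Q : incr 2 n) :
    (forall x, connect E v x) -> radical_ideal (Fitt0 (koszul_rows k (nonedges E))) ->
    P \in nonedges E -> Q \in nonedges E -> P != Q ->
  v \in P @: setT :|: Q @: setT.
Proof.
move=> /connected_parent[d [p [dv pP pv]]] rad NP NQ PQ.
(* [hi A] is the deeper vertex of [A] and [lo A] the other one; a tie makes [A ord0] the deeper. *)
pose hi (A : incr 2 n) := if (d (A ord_max) <= d (A ord0))%N then A ord0 else A ord_max.
pose lo (A : incr 2 n) := if (d (A ord_max) <= d (A ord0))%N then A ord_max else A ord0.
have imA (A : incr 2 n) : A @: setT = [set hi A; lo A].
  by rewrite imset_incr2 /hi /lo; case: ifP => _ //; rewrite setUC.
have dlo A : (d (lo A) <= d (hi A))%N.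
  by rewrite /hi /lo; case: ifP => // /negbT; rewrite -ltnNge => /ltnW.
have hilo A : hi A != lo A.
  by rewrite /hi /lo; case: ifP => _; rewrite (inj_eq (@incr_inj _ _ A)).
have nE A : A \in nonedges E -> ~~ E (hi A) (lo A).
  by rewrite (nonedges_imset (imA A)).
have d_gt0 w : w != v -> (0 < d w)%N by move/pP => /andP[_]; apply: leq_ltn_trans.
have hiv A : hi A != v.
  have := hilo A; apply: contraNneq => hv; have := dlo A; rewrite hv dv.
  by case: (eqVneq (lo A) v) => // /d_gt0; case: (d _).
pose c A := p (hi A).
have cE A : E (c A) (hi A) by have /andP[] := pP _ (hiv A).
have cd A : (d (c A) < d (hi A))%N by have /andP[] := pP _ (hiv A).
(* The parent of [hi A] is less deep than [hi A] and adjacent to it, while [lo A] is not adjacent to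
   it. *)
have cA (A : incr 2 n) : A \in nonedges E -> c A \notin A @: setT.
  move=> NA; rewrite imA !inE negb_or; apply/andP; split.
    by apply/eqP=> e; have := cd A; rewrite e ltnn.
  by have := nE A NA; apply: contraNneq => <-; rewrite hsym.
have prodJ : Fitt0 (koszul_rows k (nonedges E)) (\prod_(A in nonedges E) 'X_(c A)).
  (* The pair of [c A] and [hi A] is an edge, so [B] can only consist of [c A] and [lo A]; its depth
     sum is smaller because [c A] is less deep than [hi A]. *)
  apply: (@koszul_rows_prod _ _ _ _ (fun A => d (hi A) + d (lo A))%N) => // A B NA NB BA.
  rewrite !imA subUset !sub1set !inE => /andP[hB lB].
  have := nE B NB; have := hilo B; have := cE A; have := cd A.
  have nBA : [set hi B; lo B] != [set hi A; lo A].
    by apply: contra BA => /eqP eqBA; apply/eqP/incr_imset_inj; rewrite !imA.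
  case/or3P: hB nBA => /eqP->; case/or3P: lB => /eqP->; rewrite ?eqxx //.
  - by move=> _ _ -> .
  - by move=> _ ? _ _ _; lia.
  - by move=> _ _; rewrite hsym => ->.
  - by move=> _ ? _ _ _; lia.
  - by rewrite setUC eqxx.
pose Nv := [set A : incr 2 n in nonedges E | v \in A @: setT].
(* If the deeper vertex w of A is not adjacent to v, then {v, w} is in Nv and has
   the same c. *)
pose s := v :: [seq c A | A in Nv].
have cs A : A \in nonedges E -> c A \in s.
  move=> NA; rewrite inE; have [Evh|nEvh] := boolP (E v (hi A)).
    by rewrite /c pv ?eqxx.
  have [|B NB imB] := exists_nonedge _ nEvh; first by rewrite eq_sym.
  apply/orP; right; apply/imageP; exists B; first by rewrite inE NB imB set21.
  rewrite /c; congr p; have : hi B \in [set v; hi A] by rewrite -imB imA set21.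
  by rewrite !inE (negbTE (hiv B)) => /eqP.
apply: contraT; rewrite inE negb_or => /andP[vP vQ].
have : (#|nonedges E| <= size s)%N.
  apply: (@koszul_rows_degree k); apply: (rad _ #|nonedges E|).
  (* Each ['X_(c A)] divides the product over [s], so one copy of that product per non-edge yields a
     multiple of the monomial in [prodJ]. *)
  suff [h ->] : exists h, (\prod_(i <- s) 'X_i) ^+ #|nonedges E| =
      h * \prod_(A in nonedges E) 'X_(c A) :> {mpoly k[n]} by exact: ideal_genM.
  exists (\prod_(A in nonedges E) \prod_(i <- rem (c A) s) 'X_i).
  rewrite mulrC -big_split -prodr_const; apply: eq_bigr => A NA.
  by rewrite (big_rem (c A)) // cs.
rewrite /= size_image.
(* [P] and [Q] are not in [Nv], so this would give [2 + #|Nv| <= 1 + #|Nv|]. *)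
suff : (#|[set P; Q] :|: Nv| <= #|nonedges E|)%N.
  rewrite cardsU cards2 PQ (_ : [set P; Q] :&: Nv = set0) ?cards0 /= ?subn0.
    by move=> cN /(leq_trans cN); rewrite add2n ltnn.
  apply/setP=> A; rewrite !inE; case: eqP => [->|_]; first by rewrite (negbTE vP) andbF.
  by case: eqP => [->|_] //; rewrite (negbTE vQ) andbF.
apply/subset_leq_card/subsetP=> A; rewrite in_setU in_set2 [A \in Nv]inE.
by case/orP=> [/pred2P[]->|/andP[]].
Qed.

End Graph.

(** * Graphs whose non-edges pairwise cover or complement each other *)

Section Classification.

Variables (n : nat) (E : rel 'I_n).
Hypotheses (hsym : ssrbool.symmetric E) (hirr : irreflexive E).

(** Two non-edges sharing a vertex would exhaust the vertices and isolate the shared one, so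
    distinct non-edges are disjoint. If there are two, they cover a set of four vertices and every
    other pair is an edge. *)
Lemma cover_classification : connected_graph E ->
    (forall v (A B : incr 2 n), A \in nonedges E -> B \in nonedges E -> A != B ->
       v \in A @: setT :|: B @: setT) ->
  [\/ E =2 complete_graph (T := 'I_n),
      exists a b : 'I_n,
        a != b /\ E =2 remove_edge (complete_graph (T := 'I_n)) a b
    | graph_iso E (@cycle_graph 4)].
Proof.
move=> conn cover.
have cover2 a b c d v : a != b -> ~~ E a b -> c != d -> ~~ E c d ->
    [set a; b] != [set c; d] -> v \in [set a; b; c; d].
  move=> ab nab cd ncd neq.
  have [A NA imA] := exists_nonedge hsym ab nab.
  have [B NB imB] := exists_nonedge hsym cd ncd.
  rewrite -setUA [_ :|: [set d]]setUC -setUA setUA [[set d] :|: _]setUC -imA -imB.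
  by apply: cover => //; apply: contra neq => /eqP AB; rewrite -imA -imB AB.
have matching a b c : a != b -> a != c -> b != c -> ~~ E a b -> ~~ E a c -> False.
  move=> ab ac bc nab nac.
  have all_abc v : v \in [set a; b; a; c].
    apply: cover2 => //; apply/eqP=> /setP/(_ b); rewrite !inE eqxx orbT.
    by rewrite eq_sym (negbTE ab) (negbTE bc).
  (* The first step of a walk leaving [a] reaches a neighbour of [a], but [a], [b] and [c] are the
     only vertices. *)
  have /connectP[[|u q] /=] := conn a b; first by move=> _ ba; rewrite ba eqxx in ab.
  case/andP=> Eau _ _; have := all_abc u; rewrite !inE -!orbA.
  by case/or4P=> /eqP ua; rewrite ua ?hirr ?(negbTE nab) ?(negbTE nac) in Eau.
have [/existsP[a /existsP[b /andP[ab nab]]]|/existsPn nN] :=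
    boolP [exists a, exists b, (a != b) && ~~ E a b]; last first.
  constructor 1 => x y; rewrite /complete_graph; have := nN x; rewrite negb_exists.
  by move/forallP/(_ y); case: eqVneq => [->|_]; rewrite ?hirr //= negbK.
have [/existsP[c /existsP[d /and3P[cd ncd abcd]]]|/existsPn nN] :=
    boolP [exists c, exists d, [&& c != d, ~~ E c d & [set a; b] != [set c; d]]]; last first.
  constructor 2; exists a, b; split=> // x y; rewrite /remove_edge /complete_graph.
  have := nN x; rewrite negb_exists => /forallP/(_ y).
  have [->|xy] := eqVneq x y; first by rewrite hirr.
  have [Exy _|nExy] /= := boolP (E x y).
    apply/esym/norP; split; apply/negP=> /andP[/eqP xE /eqP yE]; move: Exy.
      by rewrite xE yE (negbTE nab).
    by rewrite xE yE hsym (negbTE nab).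
  rewrite negbK => /eqP/setP eqS; apply/esym/negbTE; rewrite negbK.
  have := eqS x; have := eqS y; rewrite !inE !eqxx orbT /= => /pred2P[yE|yE] /pred2P[xE|xE];
    by rewrite xE yE ?eqxx ?orbT // in xy *.
constructor 3.
have ac : a != c.
  apply/eqP=> ac; rewrite -{}ac in cd ncd abcd.
  apply: (matching a b d) => //; by apply: contraNneq abcd => ->.
have ad : a != d.
  apply/eqP=> ad; rewrite -{}ad in cd ncd abcd.
  apply: (matching a b c) => //; rewrite 1?eq_sym 1?hsym //.
  by apply: contraNneq abcd => ->; rewrite setUC.
have bc : b != c.
  apply/eqP=> bc; rewrite -{}bc in cd ncd abcd.
  apply: (matching b a d) => //; rewrite 1?eq_sym 1?hsym //.
have bd : b != d.
  apply/eqP=> bd; rewrite -{}bd in cd ncd abcd.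
  apply: (matching b a c) => //; rewrite 1?eq_sym 1?hsym //.
have Eac : E a c by apply: contraT => nac; case: (matching a b c).
have Ead : E a d by apply: contraT => nad; case: (matching a b d).
have Ebc : E b c by apply: contraT => nbc; case: (matching b a c) => //; rewrite 1?eq_sym 1?hsym.
have Ebd : E b d by apply: contraT => nbd; case: (matching b a d) => //; rewrite 1?eq_sym 1?hsym.
(* This cyclic order alternates between the two non-edges, making each a diagonal of the 4-cycle. *)
pose s := [:: a; c; b; d].
have in_s x : x \in s.
  have := cover2 a b c d x ab nab cd ncd abcd; rewrite !inE -!orbA.
  by case/or4P=> ->; rewrite ?orbT.
have us : uniq s.
  by rewrite /= !inE !negb_or ab ac ad bd cd eq_sym bc.
pose f x : 'I_4 := inord (index x s); pose g (i : 'I_4) := nth a s i.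
have fK : cancel f g.
  move=> x; have ltx : index x s < 4 by rewrite -[4]/(size s) index_mem.
  by rewrite /g /f inordK // nth_index.
have gK : cancel g f by move=> i; rewrite /f /g index_uniq ?inord_val.
exists f => [|x y]; first by exists g.
rewrite -{2}[x]fK -{2}[y]fK; move: (f x) (f y) => i j.
case: i => [[|[|[|[|//]]]] ?]; case: j => [[|[|[|[|//]]]] ?];
  rewrite /cycle_graph /g /= ?hirr ?Eac ?Ead ?Ebc ?Ebd ?(negbTE nab) ?(negbTE ncd) //;
  by rewrite hsym ?Eac ?Ead ?Ebc ?Ebd ?(negbTE nab) ?(negbTE ncd).
Qed.

Lemma nonedges_matching :
    [\/ E =2 complete_graph (T := 'I_n),
      exists a b : 'I_n,
        a != b /\ E =2 remove_edge (complete_graph (T := 'I_n)) a b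
      | graph_iso E (@cycle_graph 4)] ->
  forall A B : incr 2 n, A \in nonedges E -> B \in nonedges E -> A != B ->
    A @: setT = ~: (B @: setT).
Proof.
have neq (A : incr 2 n) : A ord0 != A ord_max by rewrite (inj_eq (@incr_inj _ _ A)).
case=> [Ecomp|[a [b [ab Eab]]]|[f fbij fE]] A B.
- by rewrite inE Ecomp /complete_graph neq.
- have imN (C : incr 2 n) : C \in nonedges E -> C @: setT = [set a; b].
    rewrite inE Eab /remove_edge /complete_graph neq negbK imset_incr2.
    by case/orP=> /andP[/eqP-> /eqP->]; rewrite // setUC.
  by move=> /imN imA /imN imB /eqP[]; apply: incr_imset_inj; rewrite imA imB.
have finj : injective f := bij_inj fbij.
(* The non-edges of the 4-cycle are the two parity classes of its vertices. *)
have imN (C : incr 2 n) z : C \in nonedges E -> (z \in C @: setT) = (odd (f z) == odd (f (C ord0))).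
  rewrite inE -fE imset_incr2 in_set2 -!(inj_eq finj).
  have := neq C; rewrite -(inj_eq finj); move: (f z) (f _) (f _) => l i j.
  by case: i => [[|[|[|[|//]]]] ?]; case: j => [[|[|[|[|//]]]] ?]; case: l => [[|[|[|[|//]]]] ?].
move=> NA NB AB; have: odd (f (A ord0)) != odd (f (B ord0)).
  apply: contra AB => /eqP eqo; apply/eqP/incr_imset_inj/setP => z.
  by rewrite !imN // eqo.
move=> oAB; apply/setP=> z; rewrite in_setC !imN //.
by move: oAB; case: (odd _); case: (odd _); case: (odd _).
Qed.

End Classification.

(** * The equivalence, transferred to the matrix of non-edges *)

Theorem mainTheorem1 (k : closedFieldType) (hk : [pchar k]%R =i pred0)
    (n : nat) (hn : 3 <= n)
    (V : vectType k) (e : n.-tuple V) (he : basis_of fullv e)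
    (E : rel 'I_n) (hsym : ssrbool.symmetric E) (hirr : irreflexive E) :
  radical_ideal (koszul_fitt0 e E) <->
  [\/ ~ connected_graph E,
      E =2 complete_graph (T := 'I_n),
      exists a b : 'I_n,
        a != b /\ E =2 remove_edge (complete_graph (T := 'I_n)) a b
    | graph_iso E (@cycle_graph 4)].
Proof.
have fitt0E := koszul_fitt0_rows he hsym.
have -> : radical_ideal (koszul_fitt0 e E) <-> radical_ideal (Fitt0 (koszul_rows k (nonedges E))).
  by split=> rad f m /fitt0E/rad/fitt0E.
split=> [rad|].
  have [/forallP/= conn|nconn] := boolP [forall x, forall y, connect E x y]; last first.
    by constructor 1 => conn; case/negP: nconn; apply/forallP=> x; apply/forallP=> y.
  have {}conn : connected_graph E by move=> x y; have /forallP := conn x.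
  have cover v (A B : incr 2 n) : A \in nonedges E -> B \in nonedges E -> A != B ->
      v \in A @: setT :|: B @: setT.
    by move=> NA NB AB; apply: radical_nonedges_cover rad NA NB AB => //; apply: conn.
  by case: (cover_classification hsym hirr conn cover);
    [constructor 2|constructor 3|constructor 4].
have matching_radical :
    (forall A B : incr 2 n, A \in nonedges E -> B \in nonedges E -> A != B ->
       A @: setT = ~: (B @: setT)) ->
    radical_ideal (Fitt0 (koszul_rows k (nonedges E))).
  move=> compl; apply: koszul_rows_radical => [A B NA NB AB|A B i NA NB AB].
    by rewrite (compl A B) // -setI_eq0 setIC setICr.
  by rewrite (compl A B) // setUC setUCr inE.
case=> [nconn|Ecomp|Erem|Ecyc].
- have [x [y nxy]] : exists x y, ~~ connect E x y.
    have [/forallP/= conn|] := boolP [forall x, forall y, connect E x y].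
      by case: nconn => x y; have /forallP := conn x.
    by rewrite negb_forall => /existsP[x]; rewrite negb_forall => /existsP[y]; exists x, y.
  (* The ideal is 0, which is radical because the polynomial ring is a domain. *)
  move=> f m /(koszul_rows_disconnected nxy hsym) /eqP fm0.
  suff -> : f = 0%R by apply: ideal_gen0.
  by move: fm0; rewrite GRing.expf_eq0 => /andP[_ /eqP].
- by apply/matching_radical/nonedges_matching => //; constructor 1.
- by apply/matching_radical/nonedges_matching => //; constructor 2.
- by apply/matching_radical/nonedges_matching => //; constructor 3.
Qed.
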